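(* Let $V$ be a non-negative random variable with distribution function $F_V$ and let $Y\sim\mathrm{PH}(\boldsymbol{\pi},\boldsymbol{T})$ be phase-type distributed and independent of $V$. Let $F_{VY}$ be the distribution function of the product $VY$. Then: \begin{enumerate} \item If $F_V\in\mathcal{R}$, then $F_{VY}\in\mathcal{R}$ and their indices of regular variation are the same. \item If $F_V\in\mathcal{E}$, then $F_{VY}\in\mathcal{E}$. \item If $F_V\in\mathcal{I}$, then $F_{VY}\in\mathcal{I}$. \item If $F_V\in\mathcal{D}\cap\mathcal{L}$, then $F_{VY}\in\mathcal{D}\cap\mathcal{L}$. \item If $F_V\in\mathcal{L}$, then $F_{VY}\in\mathcal{L}$. \end{enumerate}
   Context: For a distribution function $F$, $\overline{F}=1-F$. Classes of distribution functions $F$ on $[0,\infty)$ (in all cases $\overline{F}(x)>0$ for all $x$): - $\mathcal{R}$ (regularly varying): $\overline{F}(x)=x^{-\alpha}L(x)$, $x>0$, for some $\alpha>0$ (the index) and some slowly varying $L$, i.e. $L(cx)/L(x)\to1$ as $x\to\infty$ for all $c>0$. - $\mathcal{E}$ (extended regularly varying): $\liminf_{x\to\infty}\overline{F}(\lambda x)/\overline{F}(x)\ge\lambda^{-\phi}$ for some $\phi\ge0$ and all $\lambda\ge1$. - $\mathcal{I}$ (intermediate regularly varying): $\lim_{\lambda\downarrow1}\liminf_{x\to\infty}\overline{F}(\lambda x)/\overline{F}(x)=1$. - $\mathcal{D}$ (dominated varying): $\liminf_{x\to\infty}\overline{F}(\lambda x)/\overline{F}(x)>0$ for some $\lambda>1$.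 - $\mathcal{L}$ (long-tailed): $\lim_{x\to\infty}\overline{F}(x-y)/\overline{F}(x)=1$ for any $y\in\mathbb{R}$. $Y\sim\mathrm{PH}(\boldsymbol{\pi},\boldsymbol{T})$ means that $Y$ is the time until absorption of a time-homogeneous Markov jump process on $\{1,\dots,p,p+1\}$ with states $1,\dots,p$ transient and $p+1$ absorbing, with initial distribution $\boldsymbol{\pi}=(\pi_1,\dots,\pi_p)$ on the transient states (no mass at $p+1$) and $p\times p$ sub-intensity matrix $\boldsymbol{T}$; then $\mathbb{P}(Y>y)=\boldsymbol{\pi}e^{\boldsymbol{T}y}\boldsymbol{e}$ for $y>0$, with $\boldsymbol{e}$ the column vector of ones. *)

(* Defs.v *)
From HB Require Import structures.
From mathcomp Require Import all_boot all_order all_algebra.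
From mathcomp Require Import all_classical all_reals all_analysis.

Set Implicit Arguments.
Unset Strict Implicit.
Unset Printing Implicit Defensive.

Import Order.TTheory GRing.Theory Num.Theory.
Import numFieldNormedType.Exports.

Local Open Scope classical_set_scope.
Local Open Scope ring_scope.

Section distribution_classes.
Context {R : realType}.
Implicit Types F L : R -> R.

Definition distribution_function_on_nonneg F : Prop :=
  [/\ {homo F : x y / x <= y}, right_continuous F,
      forall x, x < 0 -> F x = 0 & F x @[x --> +oo] --> (1 : R)].

Definition tail F (x : R) : R := 1 - F x.

Definition unbounded_distribution F : Prop :=
  distribution_function_on_nonneg F /\ forall x, 0 < tail F x.

Definition liminf_tail_ratio F (lambda : R) : \bar R :=
  limf_einf (fun x : R => (tail F (lambda * x) / tail F x)%:E) (pinfty_nbhs R).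

Definition slowly_varying L : Prop :=
  forall c : R, 0 < c -> L (c * x) / L x @[x --> +oo] --> (1 : R).

Definition regularly_varying_with_index (alpha : R) F : Prop :=
  [/\ unbounded_distribution F, 0 < alpha &
      exists2 L : R -> R, slowly_varying L &
        forall x, 0 < x -> tail F x = x `^ (- alpha) * L x].

Definition regularly_varying F : Prop :=
  exists alpha, regularly_varying_with_index alpha F.

Definition extended_regularly_varying F : Prop :=
  unbounded_distribution F /\
  exists2 phi : R, 0 <= phi &
    forall lambda, 1 <= lambda ->
      ((lambda `^ (- phi))%:E <= liminf_tail_ratio F lambda)%E.

Definition intermediate_regularly_varying F : Prop :=
  unbounded_distribution F /\
  liminf_tail_ratio F lambda @[lambda --> (1 : R)^'+] --> 1%E.

Definition dominated_varying F : Prop :=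
  unbounded_distribution F /\
  exists2 lambda : R, 1 < lambda & (0 < liminf_tail_ratio F lambda)%E.

Definition long_tailed F : Prop :=
  unbounded_distribution F /\
  forall y : R, tail F (x - y) / tail F x @[x --> +oo] --> (1 : R).

End distribution_classes.

Section markov_jump_processes.
Context {R : realType}.

(* Entrywise sum of the series of the A ^+ k / k`!, which always converges. *)
Definition expmx n (A : 'M[R]_n) : 'M[R]_n :=
  \matrix_(i, j) limn (series (fun k : nat => (A ^+ k) i j / k`!%:R)).

(* Only the times t >= 0 are constrained. The last clause is the Markov       *)
(* property with transition probabilities P(X_{s+t} = j | X_s = i) =          *)
(* expmx (t *: Lambda) i j, multiplied out so that it makes sense for         *)
(* conditioning events of probability zero.                                   *)
Definition markov_jump_process d (Omega : measurableType d)
    (Q : probability Omega R) n (a : 'rV[R]_n) (Lambda : 'M[R]_n)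
    (X : R -> Omega -> 'I_n) : Prop :=
  [/\ forall t i, 0 <= t -> measurable [set w | X t w = i],
      forall w t, 0 <= t -> \forall s \near t^'+, X s w = X t w,
      forall w t, 0 < t -> exists i, \forall s \near t^'-, X s w = i,
      forall i, Q [set w | X 0 w = i] = (a ord0 i)%:E &
      forall (m : nat) (t : nat -> R) (i : nat -> 'I_n),
        0 <= t 0 -> nondecreasing_seq t ->
        Q (\bigcap_(k in `I_m.+2) [set w | X (t k) w = i k]) =
        (Q (\bigcap_(k in `I_m.+1) [set w | X (t k) w = i k]) *
         (expmx ((t m.+1 - t m) *: Lambda) (i m) (i m.+1))%:E)%E].

(* Started from i, the process is almost surely at i only during a bounded    *)
(* set of times. The law of the process is determined by the initial state    *)
(* and Lambda, so the choice of its realization is immaterial.                *)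
Definition transient_state n (Lambda : 'M[R]_n) (i : 'I_n) : Prop :=
  exists d (Omega : measurableType d) (Q : probability Omega R)
         (X : R -> Omega -> 'I_n),
    markov_jump_process Q (delta_mx ord0 i) Lambda X /\
    {ae Q, forall w, exists M : R, forall t, M < t -> X t w != i}.

Definition sub_intensity_matrix p (T : 'M[R]_p) : Prop :=
  (forall i j, i != j -> 0 <= T i j) /\ (forall i, \sum_j T i j <= 0).

Definition probability_vector p (pi : 'rV[R]_p) : Prop :=
  (forall i, 0 <= pi ord0 i) /\ \sum_i pi ord0 i = 1.

(* The transient states are the lshift 1 i with i : 'I_p. *)
Definition absorbing_state p : 'I_(p + 1) := rshift p ord0.

(* Rows of an intensity matrix sum to 0, whence the exit rates - T e. *)
Definition absorbing_intensity p (T : 'M[R]_p) : 'M[R]_(p + 1) :=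
  block_mx T (- (T *m const_mx 1)) 0 0.

Definition absorption_time (Omega : Type) p (X : R -> Omega -> 'I_(p + 1))
    (w : Omega) : \bar R :=
  ereal_inf [set t%:E | t in [set t | 0 <= t /\ X t w = absorbing_state p]].

(* PH(pi, T) is a property of the law of Y: the jump process may live on a    *)
(* probability space other than that of Y.                                    *)
Definition phase_type d (Omega : measurableType d) (P : probability Omega R)
    (Y : {RV P >-> R}) p (pi : 'rV[R]_p) (T : 'M[R]_p) : Prop :=
  [/\ probability_vector pi, sub_intensity_matrix T,
      forall i : 'I_p, transient_state (absorbing_intensity T) (lshift 1 i) &
      exists d' (Omega' : measurableType d') (Q : probability Omega' R)
             (X : R -> Omega' -> 'I_(p + 1)) (tau : {RV Q >-> R}),
        [/\ markov_jump_process Q (row_mx pi 0) (absorbing_intensity T) X,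
            {ae Q, forall w, (tau w)%:E = absorption_time X w} &
            forall A, measurable A -> distribution P Y A = distribution Q tau A]].

End markov_jump_processes.

Section random_variables.
Context {R : realType} d (Omega : measurableType d) (P : probability Omega R).

Definition independent_rv (X Y : {RV P >-> R}) : Prop :=
  forall A B : set R, measurable A -> measurable B ->
    P (X @^-1` A `&` Y @^-1` B) = (P (X @^-1` A) * P (Y @^-1` B))%E.

Definition distribution_function (X : Omega -> R) (x : R) : R :=
  fine (P [set w | X w <= x]).

End random_variables.

(* Main.v *)
(** Markov jump processes enter only through the light tail of [Y].  Seen at the
times [0, N, 2N, ...], a path which is not absorbed visits [p + 1] times at most
[p] states, hence is twice at the same one, and transience makes this unlikely
for [N] large.  So some [t0] is such that absorption before [t0] has probability
at least 1/2 from every state, and the tail of [Y] is exponential.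

A long-tailed [V] has a tail heavier than every exponential, so that
[P(Y > b x)] is negligible with respect to [P(V Y > x)] for every [b > 0].  On
[Y <= b x] with [b] small, [x / Y] is large and an asymptotic comparison of
[P(V > s)] with [P(V > t)] can be integrated over the law of [Y].  This gives
[liminf_tail_ratio F_V l <= liminf_tail_ratio F_VY l] for all [l > 0], which
settles all classes but the long-tailed one; there the shift [y] becomes
[y / Y], which is bounded on [Y > delta], and the event [0 < Y <= delta]
contributes little since its probability tends to 0 with [delta]. *)

Require Import Defs.
From HB Require Import structures.
From mathcomp Require Import all_boot all_order all_algebra.
From mathcomp Require Import all_classical all_reals all_analysis.
From mathcomp Require Import measurable_realfun.
From mathcomp Require Import zify ring lra.

Set Implicit Arguments.
Unset Strict Implicit.
Unset Printing Implicit Defensive.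

Import Order.TTheory GRing.Theory Num.Theory.
Import numFieldNormedType.Exports.

Local Open Scope classical_set_scope.
Local Open Scope ring_scope.

(** * Absorption of Markov jump processes *)

Section finite_decompositions.
Context d (Omega : measurableType d) (R : realType).
Context (mu : {measure set Omega -> \bar R}).
Local Open Scope ereal_scope.

Lemma measure_finite_union_le (I : finType) (S : pred I) (B : set Omega)
    (A : I -> set Omega) :
  measurable B -> (forall i, measurable (A i)) ->
  (forall w, B w -> exists2 i, S i & A i w) ->
  mu B <= \sum_(i | S i) mu (A i).
Proof.
move=> mB mA BA.
have [mU leU] : measurable (\big[setU/set0]_(i | S i) A i) /\
    mu (\big[setU/set0]_(i | S i) A i) <= \sum_(i | S i) mu (A i).
  elim/big_rec2 : _ => [|i y U _ [mU leU]].
    by split; [exact: measurable0 | rewrite measure0].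
  split; first exact: measurableU.
  by apply: (le_trans (measureU2 _ _ _)) => //; rewrite leeD2l.
apply: le_trans leU; apply: le_measure; rewrite ?inE// => w /BA[i Si Aiw].
by rewrite (bigD1 i)//=; left.
Qed.

Lemma measure_fiber_decomposition (I : finType) (S : pred I) (f : Omega -> I)
    (A : set Omega) :
  measurable A -> (forall i, measurable [set w | f w = i]) ->
  mu (A `&` [set w | S (f w)]) = \sum_(i | S i) mu (A `&` [set w | f w = i]).
Proof.
move=> mA mf.
have mfs (s : seq I) : measurable [set w | f w \in s].
  elim: s => [|i s mfs].
    by rewrite (_ : [set _ | _] = set0)// -subset0 => w; rewrite /= in_nil.
  rewrite (_ : [set _ | _] = [set w | f w = i] `|` [set w | f w \in s]).
    exact: measurableU.
  apply/seteqP; split=> w /=; rewrite in_cons.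
    by case/orP => [/eqP|]; [left|right].
  by move=> [->|->]; rewrite ?eqxx ?orbT.
have key (s : seq I) : uniq s -> mu (A `&` [set w | f w \in s]) =
    \sum_(i <- s) mu (A `&` [set w | f w = i]).
  elim: s => [_|i s IHs /= /andP[iNs us]].
    rewrite big_nil (_ : _ `&` _ = set0) ?measure0// -subset0.
    by move=> w [_ /=]; rewrite in_nil.
  rewrite big_cons -(IHs us) -measureU//; last 3 first.
  - exact: measurableI.
  - exact: measurableI.
  - rewrite -subset0 => w [[_ /= fwi] [_ /=]].
    by rewrite fwi (negbTE iNs).
  congr (mu _); rewrite -setIUr; congr (_ `&` _).
  apply/seteqP; split=> w /=; rewrite in_cons.
    by case/orP => [/eqP|]; [left|right].
  by move=> [->|->]; rewrite ?eqxx ?orbT.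
rewrite -big_filter -key; last by rewrite filter_uniq// index_enum_uniq.
congr (mu (A `&` _)); apply/seteqP; split=> w /=;
  by rewrite mem_filter mem_index_enum andbT.
Qed.

End finite_decompositions.

(** * Transition probabilities and transience *)

Section markov_kernel.
Context {R : realType}.

(** The row of the intensity matrix at the absorbing state is zero, so only the term [k = 0], the
    identity, contributes to this row of the exponential. *)
Lemma expmx_absorbing_row p (T : 'M[R]_p) (t : R) (j : 'I_(p + 1)) :
  j != absorbing_state p ->
  expmx (t *: absorbing_intensity T) (absorbing_state p) j = 0.
Proof.
move=> jD; rewrite /expmx mxE.
rewrite (_ : (fun k : nat => _) = (fun=> 0)).
  rewrite (_ : series _ = (fun=> 0)); first exact: lim_cst.
  by apply/funext => n; rewrite /series/= big1.
apply/funext => -[|k].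
  by rewrite expr0 mxE eq_sym (negbTE jD) mul0r.
rewrite exprS -mulmxE mxE big1 ?mul0r// => l _.
by rewrite mxE /absorbing_intensity block_mxEv col_mxEd row_mx0 mxE mulr0 mul0r.
Qed.

Context (n : nat) (Lambda : 'M[R]_n).
Local Notation trans t := (expmx (t *: Lambda)).
Local Open Scope ereal_scope.

Lemma markov_two_times d (Omega : measurableType d) (Q : probability Omega R)
    (a : 'rV[R]_n) (X : R -> Omega -> 'I_n) (s t : R) (i j : 'I_n) :
  markov_jump_process Q a Lambda X -> (0 <= s)%R -> (s <= t)%R ->
  Q ([set w | X s w = i] `&` [set w | X t w = j]) =
  Q [set w | X s w = i] * (trans (t - s) i j)%:E.
Proof.
move=> [_ _ _ _ markov] s0 st.
(* Times and states are constant from index 1 on, which keeps the times nondecreasing. *)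
have := markov 0%N (fun k => if k == 0%N then s else t)
  (fun k => if k == 0%N then i else j) s0.
move=> /=.
rewrite (_ : \bigcap_(k in `I_2) _ = [set w | X s w = i] `&` [set w | X t w = j]).
  rewrite (_ : \bigcap_(k in `I_1) _ = [set w | X s w = i]).
    apply=> k l kl; case: ifPn => [_|]; case: ifPn => //.
    by rewrite -!lt0n; lia.
  apply/seteqP; split=> [w /(_ 0%N isT)//|w Xw k /=].
  by rewrite ltnS leqn0 => /eqP ->.
apply/seteqP; split=> [w Xw|w [X0 X1] k /=].
  by split; [exact: (Xw 0%N) | exact: (Xw 1%N)].
by case: k => [|[|]].
Qed.

(** Transience provides a process started at [i], for which this entry of the exponential is a
    probability. *)
Lemma transient_transition_ge0 (i j : 'I_n) (t : R) :
  transient_state Lambda i -> (0 <= t)%R -> (0 <= trans t i j)%R.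
Proof.
move=> [d [W [Q [X [mX _]]]]] t0.
have := markov_two_times i j mX (lexx 0%R) t0.
case: mX => _ _ _ init _.
rewrite init mxE !eqxx mul1e subr0 -lee_fin => <-.
exact: measure_ge0.
Qed.

(** Almost surely [i] is visited at finitely many integer times only. So the probability of a visit
    at some integer time from [N] on tends to 0, and it bounds the return probability at time
    [N]. *)
Lemma transient_return_cvg0 (i : 'I_n) :
  transient_state Lambda i ->
  (trans N%:R i i)%:E @[N --> \oo] --> (0 : \bar R).
Proof.
move=> tr; have := tr => -[d [W [Q [X [mX transX]]]]].
have mk := markov_two_times i i mX (lexx 0%R).
have [measX _ _ init _] := mX.
pose F (N : nat) := [set w | X N%:R w = i].
have mF N : measurable (F N) by exact: measX.
have mtailF N : measurable (\bigcup_(j in [set j | (N <= j)%N]) F j).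
  exact: bigcup_measurable.
have supF0 : Q (lim_sup_set F) = 0.
  apply: measure_negligible; first exact: bigcap_measurable.
  apply: negligibleS transX => w supFw [M XM].
  have [N MN] : exists N : nat, (M < N%:R)%R.
    by have [N _ /(_ N (leqnn N))] := nbhs_infty_gtr M; exists N.
  have [k /= Nk XkE] := supFw N I.
  have Mk : (M < k%:R)%R by rewrite (lt_le_trans MN)// ler_nat.
  by have := XM _ Mk; rewrite XkE eqxx.
have cvg0 : Q (\bigcup_(j in [set j | (N <= j)%N]) F j) @[N --> \oo] --> 0.
  rewrite -supF0; apply: lim_sup_set_cvg => //.
  by apply: (le_lt_trans (probability_le1 _ _)) => //; rewrite ltry.
apply: (squeeze_cvge _ _ cvg0); [|exact: cvg_cst].
near=> N; apply/andP; split; first by rewrite lee_fin transient_transition_ge0.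
have := mk N%:R; rewrite init mxE !eqxx mul1e subr0 => <-//.
apply: le_measure; rewrite ?inE//.
  by apply: measurableI; exact: measX.
by move=> w [_ XN]; exists N => /=.
Unshelve. all: by end_near. Qed.

End markov_kernel.

(** * Geometric decay of the probability of not being absorbed *)

Section absorption.
Context {R : realType} (p : nat) (T : 'M[R]_p).
Local Notation Lambda := (absorbing_intensity T).
Local Notation trans t := (expmx (t *: Lambda)).
Local Notation alive X t := [set w | X t w != absorbing_state p].
Local Open Scope ereal_scope.

(** A path may leave the absorbing state, but only on a null event, by [expmx_absorbing_row]. *)
Lemma alive_after_absorption d (Omega : measurableType d)
    (Q : probability Omega R) (a : 'rV[R]_(p + 1))
    (X : R -> Omega -> 'I_(p + 1)) (s t : R) :
  markov_jump_process Q a Lambda X -> (0 <= s)%R -> (s <= t)%R ->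
  Q ([set w | X s w = absorbing_state p] `&` alive X t) = 0.
Proof.
move=> mX s0 st; have [measX _ _ _ _] := mX.
have t0 := le_trans s0 st.
rewrite (measure_fiber_decomposition _ (fun i => i != absorbing_state p))/=.
- rewrite big1// => j jD.
  by rewrite (markov_two_times _ _ mX)// expmx_absorbing_row// mule0.
- exact: measX.
- by move=> i; exact: measX.
Qed.

Lemma measurable_alive d (Omega : measurableType d)
    (Q : probability Omega R) (a : 'rV[R]_(p + 1))
    (X : R -> Omega -> 'I_(p + 1)) (t : R) :
  markov_jump_process Q a Lambda X -> (0 <= t)%R -> measurable (alive X t).
Proof.
move=> [measX _ _ _ _] t0.
rewrite (_ : [set _ | _] = ~` [set w | X t w = absorbing_state p]).
  exact/measurableC/measX.
by apply/seteqP; split=> w /= /eqP.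
Qed.

Context (transientT : forall i : 'I_p, transient_state Lambda (lshift 1 i)).

Lemma transient_unabsorbed (i : 'I_(p + 1)) :
  i != absorbing_state p -> transient_state Lambda i.
Proof.
move=> iD; case: (split_ordP i) => j ij; first by rewrite ij.
by move: iD; rewrite ij /absorbing_state (ord1 j) eqxx.
Qed.

(** Pigeonhole at the times [k * N] with [k <= p]. The bound involves neither the realization nor
    the initial law. *)
Lemma alive_le_return d (Omega : measurableType d)
    (Q : probability Omega R) (a : 'rV[R]_(p + 1))
    (X : R -> Omega -> 'I_(p + 1)) (N : nat) :
  markov_jump_process Q a Lambda X ->
  Q (alive X ((p + 1) * N)%:R) <=
  \sum_(u : 'I_(p + 1) * 'I_(p + 1) * 'I_(p + 1) |
      (u.1.1 < u.1.2)%N && (u.2 != absorbing_state p))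
    (trans ((u.1.2 - u.1.1) * N)%:R u.2 u.2)%:E.
Proof.
move=> mX; have [measX _ _ _ _] := mX.
pose I3 := ('I_(p + 1) * 'I_(p + 1) * 'I_(p + 1))%type.
(* [inl k] stands for being absorbed at time [k * N] and yet alive at the end, [inr (k, l, i)] for
   being at [i] at both times [k * N] and [l * N]. *)
pose A (v : 'I_(p + 1) + I3) := match v with
  | inl k => [set w | X (k * N)%:R w = absorbing_state p] `&`
             alive X ((p + 1) * N)%:R
  | inr u => [set w | X (u.1.1 * N)%:R w = u.2] `&`
             [set w | X (u.1.2 * N)%:R w = u.2] end.
pose S (v : 'I_(p + 1) + I3) := match v with
  | inl k => true
  | inr u => (u.1.1 < u.1.2)%N && (u.2 != absorbing_state p) end.
have mA v : measurable (A v).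
  case: v => [k|u] /=; apply: measurableI; try exact: measX.
  exact: (measurable_alive mX).
have cover w : alive X ((p + 1) * N)%:R w -> exists2 v, S v & A v w.
  move=> aw; have [[k Xk]|nabs] :=
      pselect (exists k : 'I_(p + 1), X (k * N)%:R w = absorbing_state p).
    by exists (inl k).
  pose f (k : 'I_(p + 1)) := X (k * N)%:R w.
  (* An injective self-map of a finite set is onto, so it would reach the absorbing state. *)
  have : ~~ injectiveb f.
    apply/negP => /injectiveP/injF_onto/(_ (absorbing_state p))/codomP[k fk].
    by apply: nabs; exists k.
  move=> /injectivePn[k [l kl fkl]].
  have fD m : f m != absorbing_state p by apply/eqP => fm; apply: nabs; exists m.
  have [lt_kl|lt_lk|/val_inj ekl] := ltngtP k l.
  - by exists (inr (k, l, f k)); rewrite /= ?lt_kl ?fD.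
  - by exists (inr (l, k, f k)); rewrite /= ?lt_lk ?fD.
  - by rewrite ekl eqxx in kl.
apply: le_trans (measure_finite_union_le Q _ mA cover) _.
  exact: (measurable_alive mX).
rewrite big_sumType/= big1 ?add0e => [|k _]; last first.
  by rewrite (alive_after_absorption mX)// ler_nat leq_mul// ltnW.
apply: lee_sum => u /andP[lt_u uD].
have le_u : (u.1.1 * N <= u.1.2 * N)%N by rewrite leq_mul// ltnW.
rewrite (markov_two_times _ _ mX) ?ler_nat// -natrB// -mulnBl.
rewrite -[leRHS]mul1e; apply: lee_wpmul2r; last first.
  by apply: probability_le1; exact: measX.
by rewrite lee_fin transient_transition_ge0//; exact: transient_unabsorbed.
Qed.

(** Each of the finitely many return probabilities in [alive_le_return] tends to 0 with [N]. One
    [t0] serves all processes, in particular those started at a given state. *)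
Lemma alive_half : exists2 t0 : R, (0 < t0)%R &
  forall d (Omega : measurableType d) (Q : probability Omega R)
    (a : 'rV[R]_(p + 1)) (X : R -> Omega -> 'I_(p + 1)),
  markov_jump_process Q a Lambda X -> Q (alive X t0) <= 2^-1%:E.
Proof.
pose B (N : nat) : \bar R :=
  \sum_(u : 'I_(p + 1) * 'I_(p + 1) * 'I_(p + 1) |
      (u.1.1 < u.1.2)%N && (u.2 != absorbing_state p))
    (trans ((u.1.2 - u.1.1) * N)%:R u.2 u.2)%:E.
have B0 : B N @[N --> \oo] --> 0.
  rewrite [X in _ --> X](_ : 0 = \sum_(u : 'I_(p + 1) * 'I_(p + 1) * 'I_(p + 1) |
      (u.1.1 < u.1.2)%N && (u.2 != absorbing_state p)) 0 :> \bar R); last first.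
    by rewrite big1.
  apply: cvg_nnesum => u /andP[lt_u /transient_unabsorbed tr].
    by apply: nearW => N; rewrite lee_fin transient_transition_ge0.
  apply: (@cvg_comp _ _ _ (muln (u.1.2 - u.1.1)) (fun N => (trans N%:R u.2 u.2)%:E)).
    by apply: cvg_mulnl; rewrite subn_gt0.
  exact: transient_return_cvg0.
have [N [N0 BN]] : exists N : nat, (0 < N)%N /\ B N <= 2^-1%:E.
  have half0 : (0 : \bar R) < 2^-1%:E by rewrite lte_fin invr_gt0.
  have ltB : \forall N \near \oo, B N < 2^-1%:E.
    have := B0 [set x | x < 2^-1%:E]; apply.
    by apply: open_nbhs_nbhs; split => //; exact: open_ereal_lt_ereal.
  near \oo => N; exists N; split; first by near: N; exact: nbhs_infty_gt.
  by apply: ltW; near: N.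
exists ((p + 1) * N)%:R; first by rewrite ltr0n muln_gt0 addn1.
move=> d Omega Q a X mX; exact: le_trans (alive_le_return N mX) BN.
Unshelve. all: by end_near. Qed.

(** By the Markov property at time [n%:R * t0], surviving one more period has probability at most
    1/2 from each unabsorbed state. *)
Lemma alive_geometric : exists2 t0 : R, (0 < t0)%R &
  forall d (Omega : measurableType d) (Q : probability Omega R)
    (a : 'rV[R]_(p + 1)) (X : R -> Omega -> 'I_(p + 1)),
  markov_jump_process Q a Lambda X ->
  forall n : nat, Q (alive X (n%:R * t0)%R) <= (2^-1 ^+ n)%:E.
Proof.
have [t0 t0gt0 half] := alive_half; exists t0 => // d Omega Q a X mX.
(* The process started at [i] turns [alive_half] into a bound on a row sum of the transition
   matrix. *)
have trans_half (i : 'I_(p + 1)) : i != absorbing_state p ->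
    \sum_(j | j != absorbing_state p) (trans t0 i j)%:E <= 2^-1%:E.
  move=> /transient_unabsorbed[d' [W' [Q' [X' [mX' _]]]]].
  have [measX' _ _ init' _] := mX'.
  have t0ge0 := ltW t0gt0.
  apply: le_trans (half _ _ _ _ _ mX').
  apply: (@le_trans _ _ (Q' ([set w | X' 0%R w = i] `&` alive X' t0))).
    rewrite (measure_fiber_decomposition _ (fun i => i != absorbing_state p))/=.
    - apply: lee_sum => j _.
      rewrite (markov_two_times _ _ mX')// subr0 init'.
      by rewrite [delta_mx _ _ _ _]mxE !eqxx mul1e.
    - exact: measX'.
    - by move=> j; exact: measX'.
  apply: le_measure; rewrite ?inE//.
  - by apply: measurableI; [exact: measX'|exact: (measurable_alive mX')].
  - exact: (measurable_alive mX').
have [measX _ _ _ _] := mX.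
elim=> [|n IHn].
  rewrite expr0 probability_le1//; apply: (measurable_alive mX).
  by rewrite mul0r.
have s0 : (0 <= n%:R * t0)%R by rewrite mulr_ge0// ltW.
have st : (n%:R * t0 <= n.+1%:R * t0)%R by rewrite ler_pM2r// ler_nat.
have ts : (n.+1%:R * t0 - n%:R * t0 = t0)%R.
  by rewrite -mulrBl -natr1 addrAC subrr add0r mul1r.
have mt : measurable (alive X (n.+1%:R * t0)%R).
  exact: (measurable_alive mX (le_trans s0 st)).
have mfib (i : 'I_(p + 1)) : measurable [set w | X (n%:R * t0)%R w = i].
  exact: measX.
have step : Q (alive X (n.+1%:R * t0)%R) <=
    \sum_(i | i != absorbing_state p) Q [set w | X (n%:R * t0)%R w = i] * 2^-1%:E.
  apply: (@le_trans _ _ (\sum_i Q ([set w | X (n%:R * t0)%R w = i] `&`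
                                   alive X (n.+1%:R * t0)%R))).
    apply: measure_finite_union_le => // [i|w aw]; first exact: measurableI.
    by exists (X (n%:R * t0)%R w).
  (* Paths already absorbed contribute 0. *)
  rewrite (bigD1 (absorbing_state p))//= (alive_after_absorption mX)// add0e.
  apply: lee_sum => i iD.
  rewrite (measure_fiber_decomposition _ (fun i => i != absorbing_state p))//=.
    under eq_bigr do rewrite (markov_two_times _ _ mX s0 st) ts.
    rewrite -ge0_sume_distrr; last first.
      move=> j jD; rewrite lee_fin transient_transition_ge0//; last exact: ltW.
      exact: transient_unabsorbed.
    by apply: lee_wpmul2l => //; exact: trans_half.
  by move=> j; apply: measX; exact: le_trans st.
apply: le_trans step _.
rewrite -ge0_sume_distrl// -(setTI (alive _ _)) in IHn *.
rewrite exprSr EFinM; apply: lee_wpmul2r; first by rewrite lee_fin invr_ge0.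
rewrite (measure_fiber_decomposition _ (fun i => i != absorbing_state p))//= in IHn.
by under eq_bigr do rewrite -(setTI [set _ | _]).
Qed.
End absorption.

(** * Phase-type laws *)

Lemma ae_le_measure d (Omega : measurableType d) (R : realType)
    (mu : {measure set Omega -> \bar R}) (A B : set Omega) :
  measurable A -> measurable B -> {ae mu, forall w, A w -> B w} ->
  (mu A <= mu B)%E.
Proof.
move=> mA mB [N [mN muN0 subN]].
apply: (@le_trans _ _ (mu (B `|` N))).
  apply: le_measure; rewrite ?inE//; first exact: measurableU.
  move=> w Aw; have [Bw|nBw] := pselect (B w); [by left|right].
  by apply: subN => /(_ Aw).
by rewrite -[leRHS]adde0 -muN0; exact: measureU2.
Qed.

Lemma gt_preimageE (Omega : Type) (R : realType) (X : Omega -> R) (c : R) :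
  [set w | c < X w] = X @^-1` `]c, +oo[%classic.
Proof. by apply/seteqP; split=> w /=; rewrite in_itv /= andbT. Qed.

Lemma measurable_gt d (Omega : measurableType d) (R : realType)
    (X : {mfun Omega >-> R}) (c : R) : measurable [set w | c < X w].
Proof. by rewrite gt_preimageE; exact: measurable_funPTI. Qed.

Section phase_type_law.
Context {R : realType} d (Omega : measurableType d) (P : probability Omega R).
Context (Y : {RV P >-> R}) (p : nat) (pi : 'rV[R]_p) (T : 'M[R]_p).
Context (Y_PH : phase_type Y pi T).
Local Notation Delta := (absorbing_state p).

(** Moves the tail events of [Y] to the space of the jump process. *)
Lemma phase_type_realization : exists d' (W : measurableType d')
    (Q : probability W R) (X : R -> W -> 'I_(p + 1)) (tau : {RV Q >-> R}),
  [/\ markov_jump_process Q (row_mx pi 0) (absorbing_intensity T) X,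
      {ae Q, forall w, (tau w)%:E = absorption_time X w},
      forall c : R, measurable [set w | c < tau w] &
      forall c : R, P [set w | c < Y w] = Q [set w | c < tau w]].
Proof.
have [_ _ _ [d' [W [Q [X [tau [mX tauE YE]]]]]]] := Y_PH.
exists d', W, Q, X, tau; split=> // c; first exact: measurable_gt.
rewrite !gt_preimageE; exact: (YE _ (measurable_itv _)).
Qed.

(** Outside a null set [tau] is an infimum of nonnegative times. *)
Lemma phase_type_lt0 : P [set w | Y w < 0] = 0%E.
Proof.
have [_ _ _ [d' [W [Q [X [tau [_ tauE YE]]]]]]] := Y_PH.
have -> : P [set w | Y w < 0] = Q [set w | tau w < 0].
  rewrite -[LHS]/(P (Y @^-1` [set x | x < 0])).
  rewrite -[RHS]/(distribution Q tau [set x | x < 0]).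
  by rewrite -YE// -set_itvNyo; exact: measurable_itv.
apply/eqP; rewrite eq_le measure_ge0 andbT -(measure0 Q).
apply: ae_le_measure => //.
  rewrite (_ : [set _ | _] = tau @^-1` `]-oo, 0[%classic); last first.
    by apply/seteqP; split=> w /=; rewrite in_itv.
  exact: measurable_funPTI.
apply: filterS tauE => w tw /=; rewrite ltNge => /negP; apply.
rewrite -lee_fin tw; apply: le_ereal_inf_tmp => _ [t [t0 _] <-].
by rewrite lee_fin.
Qed.

(** Without initial mass at the absorbing state, right-continuity makes [tau] almost surely
    positive. The event [0 < tau] is the union of the events [n.+1%:R^-1 < tau], which cannot all be
    null. *)
Lemma phase_type_pos : exists2 c : R, 0 < c & (0 < P [set w | (c < Y w)%R])%E.
Proof.
have [d' [W [Q [X [tau [mX tauE mtau YtauE]]]]]] := phase_type_realization.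
have [measX rcX _ init _] := mX.
have tau_gt0 : Q [set w | 0 < tau w] = 1%E.
  apply/eqP; rewrite eq_le probability_le1//=.
  have <- : Q (~` [set w | X 0 w = Delta]) = 1%E.
    rewrite probability_setC ?init; last exact: measX.
    by rewrite /absorbing_state row_mxEr mxE sube0.
  apply: ae_le_measure => //; first exact/measurableC/measX.
  apply: filterS tauE => w tw X0.
  have [e /= e0 Xe] := rcX w 0 (lexx 0).
  rewrite -lte_fin tw (@lt_le_trans _ _ e%:E) ?lte_fin//.
  apply: le_ereal_inf_tmp => _ [t [t0 Xt] <-]; rewrite lee_fin leNgt.
  apply/negP => te; apply: X0.
  (* The right neighbourhood of 0 does not contain 0 itself. *)
  have [t00|tn0] := eqVneq t 0; first by rewrite /= -[in LHS]t00.
  rewrite /= -(Xe t) ?lt_neqAle ?t0 1?eq_sym ?tn0//=.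
  by rewrite sub0r normrN ger0_norm.
apply: contrapT => none.
suff : Q [set w | 0 < tau w] = 0%E by rewrite tau_gt0 => /eqP; rewrite onee_eq0.
apply: measure_negligible => //.
apply: (@negligibleS _ _ _ _ (\bigcup_n [set w | n.+1%:R^-1 < tau w])).
  move=> w /= tw; have [n _ /(_ _ (leqnn n))/= ltn] := nbhs_infty_gtr (tau w)^-1.
  exists n => //=; rewrite invf_plt ?posrE// (lt_trans ltn)// ltr_nat//.
apply: negligible_bigcup => n; exists [set w | n.+1%:R^-1 < tau w]; split => //.
apply/eqP; rewrite eq_le measure_ge0 andbT leNgt; apply/negP => pos.
by apply: none; exists n.+1%:R^-1 => //; rewrite YtauE.
Qed.

(** [alive_geometric] is applied at the last multiple of [t0] not exceeding [y]. *)
Lemma phase_type_exponential_tail : exists K c : R, [/\ 0 < K, 0 < c &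
  forall y : R, 0 <= y ->
    (P [set w | (y < Y w)%R] <= (K * expR (- (c * y)))%:E)%E].
Proof.
have [d' [W [Q [X [tau [mX tauE mtau YtauE]]]]]] := phase_type_realization.
have [_ _ trT _] := Y_PH.
have [t0 t0gt0 /(_ _ _ _ _ _ mX) geom] := alive_geometric trT.
(* The rate makes [expR (- (c * y))] the power of 1/2 with exponent [y / t0]; the constant 2 pays
   for rounding this exponent down. *)
exists 2, (ln 2 / t0); split; rewrite ?divr_gt0 ?ln_gt0 ?ltr1n// => y y0.
pose n := Num.truncn (y / t0).
have yt0 : 0 <= y / t0 by rewrite divr_ge0// ltW.
have /andP[ny yn] := truncn_itv yt0.
rewrite YtauE; apply: (@le_trans _ _ (2^-1 ^+ n)%:E).
  apply: le_trans (geom n); have s0 : 0 <= n%:R * t0 by rewrite mulr_ge0// ltW.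
  apply: ae_le_measure => //; first exact: (measurable_alive mX).
  apply: filterS tauE => w tw /= yw; apply/negP => /eqP XD.
  move: yw; rewrite ltNge => /negP; apply.
  apply: (@le_trans _ _ (n%:R * t0)); last by rewrite -ler_pdivlMr.
  by rewrite -lee_fin tw; apply: ereal_inf_lbound; exists (n%:R * t0).
rewrite lee_fin exprVn -[X in X ^- _]lnK ?posrE// -expRM_natl -expRN.
rewrite -{2}[2]lnK ?posrE// -expRD ler_expR.
have ln2 : 0 < ln (2 : R) by rewrite ln_gt0// ltr1n.
have -> : ln 2 / t0 * y = ln 2 * (y / t0) by field; rewrite gt_eqF.
rewrite -mulr_natr mulrC.
by move: yn; rewrite -natr1 => yn; nra.
Qed.

End phase_type_law.

(** * The tail of a product of independent factors *)

Section distribution_functions.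
Context {R : realType} d (Omega : measurableType d) (P : probability Omega R).
Implicit Types X : {RV P >-> R}.

Lemma le_preimageE (X : Omega -> R) (c : R) :
  [set w | X w <= c] = X @^-1` `]-oo, c]%classic.
Proof. by apply/seteqP; split=> w /=; rewrite in_itv. Qed.

Lemma tail_distribution_function X (x : R) :
  tail (distribution_function P X) x = fine (P [set w | x < X w]).
Proof.
have mX : measurable [set w | X w <= x].
  by rewrite le_preimageE; exact: measurable_funPTI.
rewrite /tail /distribution_function.
have -> : [set w | x < X w] = ~` [set w | X w <= x].
  by apply/seteqP; split=> w /=; rewrite ltNge => /negP.
by rewrite probability_setC// fineB ?fin_num_measure//.
Qed.

Lemma nonneg_distribution_function X : P [set w | X w < 0] = 0%E ->
  distribution_function_on_nonneg (distribution_function P X).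
Proof.
move=> X0.
have FE : distribution_function P X = fine \o cdf X.
  by apply/funext => x; rewrite /distribution_function le_preimageE.
have cdf_fin x : cdf X x \is a fin_num by exact: fin_num_measure.
rewrite FE; split.
- by move=> x y xy /=; rewrite fine_le// cdf_nondecreasing.
- move=> x; apply: fine_cvg; rewrite /= fineK//.
  exact: cdf_right_continuous.
- move=> x x0 /=; apply/eqP; rewrite -eqe fineK// eq_le cdf_ge0 andbT.
  rewrite -[leRHS]/(0%E) -X0 -[leLHS]/(P (X @^-1` `]-oo, x]%classic)).
  apply: le_measure; rewrite ?inE//.
  + exact: measurable_funPTI.
  + rewrite (_ : [set _ | _] = X @^-1` `]-oo, 0[%classic); first exact: measurable_funPTI.
    by apply/seteqP; split=> w /=; rewrite in_itv.
  + by move=> w /=; rewrite in_itv /= => /le_lt_trans; exact.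
- by apply: fine_cvg; exact: cvg_cdfy1.
Qed.

(** The events [0 < X <= n.+1%:R^-1] decrease to the empty set. The value 0 is left out, since [X]
    may have an atom there. *)
Lemma small_positive_prob X (e : R) : 0 < e ->
  exists2 delta : R, 0 < delta &
    forall t, t <= delta -> fine (P [set w | 0 < X w <= t]) <= e.
Proof.
move=> e0.
have mI t : measurable [set w | 0 < X w <= t].
  rewrite (_ : [set _ | _] = X @^-1` `]0, t]%classic); first exact: measurable_funPTI.
  by apply/seteqP; split=> w /=; rewrite in_itv.
pose F (n : nat) := [set w | 0 < X w <= n.+1%:R^-1].
have F0 : \bigcap_n F n = set0.
  rewrite -subset0 => w Fw; have /andP[Xw _] := Fw 0%N I.
  have [n _ /(_ _ (leqnn n))/= ltn] := nbhs_infty_gtr (X w)^-1.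
  have /andP[_] := Fw n I; rewrite leNgt => /negP; apply.
  by rewrite invf_plt ?posrE// (lt_trans ltn)// ltr_nat.
have PF : P (F n) @[n --> \oo] --> P (\bigcap_n F n).
  apply: nonincreasing_cvg_mu => //.
  - exact: (le_lt_trans (probability_le1 _ (mI _)) (ltry _)).
  - by move=> n; exact: mI.
  - by rewrite F0.
  - move=> n m nm; apply/subsetPset => w /andP[Xw Xm]; apply/andP; split=> //.
    apply: le_trans Xm _.
    by rewrite lef_pV2 ?posrE// ler_nat.
rewrite F0 measure0 in PF.
have fPF : (fine \o (P \o F)) n @[n --> \oo] --> (0 : R) by exact: fine_cvg PF.
have [n _ /(_ n (leqnn n))/= Fe] := (cvgr0Pnorm_lt _).1 fPF e e0.
exists n.+1%:R^-1 => // t tn; apply: le_trans (ltW Fe).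
apply: le_trans (ler_norm _); apply: fine_le.
- exact/fin_num_measure/mI.
- exact/fin_num_measure/mI.
apply: le_measure; rewrite ?inE; [exact: mI|exact: mI|move=> w /andP[Xw Xt]].
by apply/andP; split=> //; exact: le_trans tn.
Qed.

End distribution_functions.

(** * Bounds for the tail of the product *)

Section product.
Context {R : realType} d (Omega : measurableType d) (P : probability Omega R).
Context (V Y : {RV P >-> R}).
Context (V_ge0 : forall w, 0 <= V w).
Context (VY_indep : independent_rv V Y).

Definition product_rv : {RV P >-> R} :=
  mfun_Sub (mem_set (measurable_funM (measurable_funPT V) (measurable_funPT Y))).

(** A product measure is determined on rectangles, where independence applies. [Y] comes first in
    the pair, so that sections are taken at a fixed value of [Y]. *)
Lemma joint_law (A : set (R * R)) : measurable A ->
  P [set w | A (Y w, V w)] = (distribution P Y \x distribution P V)%E A.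
Proof.
move=> mA; pose YV : {RV P >-> (R * R)%type} :=
  mfun_Sub (mem_set (measurable_fun_pair (measurable_funPT Y) (measurable_funPT V))).
rewrite (@product_measure_unique _ _ _ _ _ (distribution P Y) (distribution P V)
  (distribution P YV))// => B C mB mC.
by rewrite /distribution /pushforward /= muleC -VY_indep// setIC.
Qed.

(** Both probabilities are integrals over the law of [Y] of probabilities for [V] alone, so a
    comparison for each fixed [u] integrates. *)
Lemma joint_law_le (A B : set (R * R)) (c : R) :
  measurable A -> measurable B -> 0 <= c ->
  (forall u, P [set w | A (u, V w)] <= c%:E * P [set w | B (u, V w)])%E ->
  (P [set w | A (Y w, V w)] <= c%:E * P [set w | B (Y w, V w)])%E.
Proof.
move=> mA mB c0 AB; rewrite !joint_law// /product_measure1.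
rewrite -ge0_integralZl//=; last exact: measurable_fun_xsection.
apply: ge0_le_integral => //=.
- exact: measurable_fun_xsection.
- exact/measurable_funeM/measurable_fun_xsection.
- move=> u _; have := AB u; rewrite /distribution /pushforward.
  rewrite (_ : V @^-1` xsection A u = [set w | A (u, V w)]); last first.
    by apply/seteqP; split=> w; rewrite /= /xsection/= inE.
  rewrite (_ : V @^-1` xsection B u = [set w | B (u, V w)])//.
  by apply/seteqP; split=> w; rewrite /= /xsection/= inE.
Qed.

Local Notation tailV := (tail (distribution_function P V)).
Local Notation tailVY := (tail (distribution_function P (fun w => V w * Y w))).
Local Notation pr A := (fine (P A)).

Lemma tail_productE (x : R) : tailVY x = pr [set w | x < V w * Y w].
Proof. exact: (tail_distribution_function product_rv). Qed.

(** The independent events [c < Y] and [x / c < V] together force [x < V * Y]. *)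
Lemma product_tail_ge (c x : R) : 0 < c ->
  pr [set w | c < Y w] * tailV (x / c) <= tailVY x.
Proof.
move=> c0; rewrite tail_productE tail_distribution_function mulrC.
rewrite -fineM ?fin_num_measure//; [|exact: measurable_gt..].
rewrite (gt_preimageE V) (gt_preimageE Y) -VY_indep//.
have mVY : measurable [set w | x < V w * Y w] by exact: (measurable_gt product_rv).
apply: fine_le; rewrite ?fin_num_measure//.
  by apply: measurableI; exact: measurable_funPTI.
apply: le_measure; rewrite ?inE//.
  by apply: measurableI; exact: measurable_funPTI.
move=> w [/=]; rewrite !in_itv /= !andbT => xV cY.
rewrite ltr_pdivrMr// in xV; apply: lt_le_trans xV _.
by apply: ler_wpM2l => //; exact: ltW.
Qed.

(** The event [s < V * Y] is split by the size of [Y]: up to [delta] it forces [s / delta < V],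
    between [delta] and [b] the comparison is integrated over the law of [Y], and beyond [b] only
    [Y] is kept. *)
Lemma product_tail_le (s t c delta b : R) :
  0 < s -> 0 <= delta -> 0 <= c ->
  (forall u, delta < u -> u <= b -> tailV (s / u) <= c * tailV (t / u)) ->
  tailVY s <= pr [set w | 0 < Y w <= delta] * tailV (s / delta) +
              c * tailVY t + pr [set w | b < Y w].
Proof.
move=> s0 delta0 c0 comp.
have mgt x : measurable [set w | x < V w * Y w] by exact: (measurable_gt product_rv).
have mYb : measurable [set w | b < Y w] by exact: measurable_gt.
have mI l r : measurable [set w | l < Y w <= r].
  rewrite (_ : [set _ | _] = Y @^-1` `]l, r]%classic); first exact: measurable_funPTI.
  by apply/seteqP; split=> w /=; rewrite in_itv.
pose A x : set (R * R) := [set z | delta < z.1 <= b /\ x < z.2 * z.1].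
have mA x : measurable (A x).
  rewrite (_ : A x = (`]delta, b]%classic `*` setT) `&`
     (setT `&` (fun z : R * R => z.2 * z.1) @^-1` `]x, +oo[%classic)).
    apply: measurableI; first exact: measurableX.
    by apply: (measurable_funM measurable_snd measurable_fst).
  apply/seteqP; split=> -[u v]; rewrite /A/= !in_itv/= andbT.
    by move=> [-> ->].
  by move=> [[-> _] [_ ->]].
have mAw x : measurable [set w | A x (Y w, V w)].
  rewrite (_ : [set _ | _] = [set w | delta < Y w <= b] `&` [set w | x < V w * Y w])//.
  exact: measurableI.
have Ale : (P [set w | A s (Y w, V w)] <= c%:E * P [set w | A t (Y w, V w)])%E.
  apply: joint_law_le => // u; rewrite /A /=.
  have [/andP[du ub]|nu] := boolP (delta < u <= b); last first.
    rewrite (_ : [set _ | _] = set0) ?measure0 ?mule_ge0//.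
    by rewrite -subset0 => w [].
  have u0 : 0 < u by exact: le_lt_trans du.
  have E x : [set w | true /\ x < V w * u] = [set w | x / u < V w].
    by apply/seteqP; split=> w /=; rewrite ltr_pdivrMr//; case.
  rewrite !E; have := comp u du ub; rewrite !tail_distribution_function.
  by rewrite -lee_fin EFinM !fineK// fin_num_measure//; exact: measurable_gt.
have cover : (P [set w | (s < V w * Y w)%R] <=
    P ([set w | (0 < Y w <= delta)%R] `&` [set w | (s < V w * Y w)%R]) +
    P [set w | A s (Y w, V w)] + P [set w | (b < Y w)%R])%E.
  have mS : measurable ([set w | 0 < Y w <= delta] `&` [set w | s < V w * Y w]).
    exact: measurableI.
  apply: (@le_trans _ _ (P (([set w | 0 < Y w <= delta] `&` [set w | s < V w * Y w])
      `|` [set w | A s (Y w, V w)] `|` [set w | b < Y w]))).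
    apply: le_measure; rewrite ?inE//; first by do 2 apply: measurableU => //.
    (* As [s] is positive and [V] nonnegative, [Y] must be positive. *)
    move=> w /= sVY; have Y0 : 0 < Y w.
      rewrite ltNge; apply/negP => Y0; move: sVY; rewrite ltNge => /negP; apply.
      by rewrite (le_trans _ (ltW s0))// mulr_ge0_le0.
    have [bY|Yb] := ltP b (Y w); first by right.
    left; have [dY|Yd] := ltP delta (Y w); first by right; rewrite /A/= dY Yb.
    by left; rewrite Y0.
  apply: le_trans (measureU2 _ _ _) _ => //; first exact: measurableU.
  by rewrite leeD2r//; apply: measureU2.
rewrite tail_productE tail_productE tail_distribution_function.
have small : (P ([set w | (0 < Y w <= delta)%R] `&` [set w | (s < V w * Y w)%R]) <=
    P [set w | (0 < Y w <= delta)%R] * P [set w | (s / delta < V w)%R])%E.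
  (* For [delta = 0] the event is empty, so the value of [s / 0] is irrelevant. *)
  have [d0|dN0] := eqVneq delta 0.
    rewrite (_ : _ `&` _ = set0) ?measure0 ?mule_ge0//.
    by rewrite -subset0 => w [/= /andP[Y0 Yd]]; move: Y0; rewrite ltNge -d0 Yd.
  have dp : 0 < delta by rewrite lt_neqAle eq_sym dN0.
  rewrite muleC (gt_preimageE V).
  rewrite (_ : [set w | 0 < Y w <= delta] = Y @^-1` `]0, delta]%classic); last first.
    by apply/seteqP; split=> w /=; rewrite in_itv.
  rewrite -VY_indep//; apply: le_measure; rewrite ?inE//.
  - by apply: measurableI => //; exact: measurable_funPTI.
  - by apply: measurableI; exact: measurable_funPTI.
  move=> w /=; rewrite !in_itv/= => -[/andP[Y0 Yd] sVY].
  rewrite Y0 Yd andbT ltr_pdivrMr//; split=> //.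
  by apply: lt_le_trans sVY _; exact: ler_wpM2l.
have Asub : (P [set w | A t (Y w, V w)] <= P [set w | (t < V w * Y w)%R])%E.
  by apply: le_measure; rewrite ?inE// => w [].
rewrite -lee_fin !EFinD !EFinM !fineK ?fin_num_measure//; [|exact: measurable_gt..].
apply: le_trans cover _; rewrite leeD2r// leeD//.
by apply: le_trans Ale _; exact: lee_wpmul2l.
Qed.

Lemma product_lt0 : P [set w | (Y w < 0)%R] = 0%E ->
  P [set w | (V w * Y w < 0)%R] = 0%E.
Proof.
move=> Y0; have mlt (X : {RV P >-> R}) : measurable [set w | X w < 0].
  rewrite (_ : [set _ | _] = X @^-1` `]-oo, 0[%classic); first exact: measurable_funPTI.
  by apply/seteqP; split=> w /=; rewrite in_itv.
apply/eqP; rewrite eq_le measure_ge0 andbT -Y0.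
apply: le_measure; rewrite ?inE//; first exact: (mlt product_rv).
move=> w /=; rewrite !ltNge; apply: contra => Yw0.
exact: mulr_ge0.
Qed.

End product.

(** * Classes of distribution functions *)

Section distribution_classes.
Context {R : realType}.
Implicit Types F : R -> R.

Lemma tail_nonincreasing F x y : unbounded_distribution F -> x <= y ->
  tail F y <= tail F x.
Proof. by move=> [[homoF _ _ _] _] xy; rewrite /tail lerB// homoF. Qed.

(** The liminf is a supremum of infima over neighbourhoods of infinity; this lemma and
    [near_le_liminf] exchange it for eventual bounds. *)
Lemma near_lt_liminf F (l r : R) : (r%:E < liminf_tail_ratio F l)%E ->
  \forall x \near +oo, r < tail F (l * x) / tail F x.
Proof.
rewrite /liminf_tail_ratio limf_einfE => /ereal_sup_gt[_ [A nA <-]] rA.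
apply: filterS nA => x Ax; rewrite -lte_fin; apply: lt_le_trans rA _.
by apply: ereal_inf_lbound; exists x.
Qed.

Lemma near_le_liminf F (l r : R) :
  (\forall x \near +oo, r <= tail F (l * x) / tail F x) ->
  (r%:E <= liminf_tail_ratio F l)%E.
Proof.
move=> nr; rewrite /liminf_tail_ratio limf_einfE.
apply: le_trans (ereal_sup_ubound _); last first.
  by exists [set x | r <= tail F (l * x) / tail F x]; [exact: nr|reflexivity].
by apply: le_ereal_inf_tmp => _ [x /= rx <-]; rewrite lee_fin.
Qed.

Lemma liminf_tail_ratio_le1 F (l : R) : unbounded_distribution F -> 1 <= l ->
  (liminf_tail_ratio F l <= 1)%E.
Proof.
move=> uF l1; rewrite leNgt; apply/negP => /near_lt_liminf lim.
near (pinfty_nbhs R) => x.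
have x0 : 0 <= x by near: x; apply: nbhs_pinfty_ge; exact: num_real.
have : 1 < tail F (l * x) / tail F x by near: x.
rewrite ltr_pdivlMr ?uF.2// mul1r ltNge tail_nonincreasing//.
by rewrite ler_peMl.
Unshelve. all: by end_near. Qed.

(** Monotonicity of the tail gives one of the two bounds in the limit, and negative shifts reduce to
    positive ones by translating [x]. *)
Lemma long_tailedP F : unbounded_distribution F ->
  long_tailed F <-> (forall y e : R, 0 < y -> 0 < e ->
    \forall x \near +oo, tail F (x - y) <= (1 + e) * tail F x).
Proof.
move=> uF; have [_ F0] := uF; split=> [[_ LF] y e y0 e0|H].
  have /cvgrPdist_le/(_ e e0) := LF y; apply: filterS => x.
  rewrite distrC => /(le_trans (ler_norm _)).
  by rewrite lerBlDl ler_pdivrMr.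
split=> // y; apply/cvgrPdist_le => e e0.
have y0 : 0 < `|y| + 1 by rewrite ltr_wpDl.
have He := H _ _ y0 e0.
have [yge|ylt] := leP 0 y.
  near=> x.
  have h : tail F (x - (`|y| + 1)) <= (1 + e) * tail F x by near: x.
  rewrite distrC ger0_norm ?subr_ge0.
    rewrite lerBlDl ler_pdivrMr//; apply: le_trans h.
    by apply: tail_nonincreasing => //; rewrite ger0_norm// lerD2l lerN2 lerDl.
  by rewrite ler_pdivlMr// mul1r tail_nonincreasing// gerBl.
(* For negative [y] the bound is used at [x - y]: going back by [|y| + 1] leads to [x - 1], to the
   left of [x]. *)
have He' : \forall x \near +oo,
    tail F (x - y - (`|y| + 1)) <= (1 + e) * tail F (x - y).
  have [M [Mr MH]] := He; exists (M + y); split; first exact: num_real.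
  by move=> z Mz; apply: MH; rewrite ltrBrDr.
near=> x.
have h : tail F (x - y - (`|y| + 1)) <= (1 + e) * tail F (x - y) by near: x.
have hx : tail F x <= (1 + e) * tail F (x - y).
  apply: le_trans h; apply: tail_nonincreasing => //.
  by rewrite ltr0_norm//; lra.
rewrite ger0_norm ?subr_ge0.
  rewrite lerBlDl -lerBlDr ler_pdivlMr//.
  have := F0 x; have := F0 (x - y); move: hx.
  have : tail F (x - y) <= tail F x by apply: tail_nonincreasing => //; lra.
  move: (tail F x) (tail F (x - y)) => a b ba aeb b0 a0.
  nra.
by rewrite ler_pdivrMr// mul1r tail_nonincreasing//; lra.
Unshelve. all: by end_near. Qed.

(** The threshold is made positive because it is inverted later. *)
Lemma near_gt_ex (A : set R) : (\forall x \near +oo, A x) ->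
  exists2 M : R, 0 < M & forall x, M <= x -> A x.
Proof.
move=> [M [_ MA]]; exists (Num.max 0 M + 1).
  by rewrite ltr_wpDl// le_max lexx.
move=> x Mx; apply: MA; apply: lt_le_trans Mx.
by rewrite (@le_lt_trans _ _ (Num.max 0 M))// ?le_max ?lexx ?orbT// ltrDl.
Qed.

(** With shift 1 and [1 + e = expR eta], each unit step beyond [z0] divides the tail by at most
    [expR eta]. *)
Lemma long_tailed_exp_lower F (eta : R) : long_tailed F -> 0 < eta ->
  exists k z0 : R, [/\ 0 < k, 0 < z0 &
    forall z, z0 <= z -> k * expR (- (eta * z)) <= tail F z].
Proof.
move=> LF eta0; have uF := LF.1; have F0 := uF.2.
have e0 : 0 < expR eta - 1 by rewrite subr_gt0 expR_gt1.
have [z0 z0gt0 step] := near_gt_ex ((long_tailedP uF).1 LF 1 _ ltr01 e0).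
have geom n : tail F z0 * expR (- (eta * n%:R)) <= tail F (z0 + n%:R).
  elim: n => [|n IHn]; first by rewrite mulr0 oppr0 expR0 mulr1 addr0.
  have /step : z0 <= z0 + n.+1%:R by rewrite lerDl.
  rewrite -natr1 addrA addrK addrCA subrr addr0 => le1.
  rewrite mulrDr mulr1 opprD expRD mulrA (expRN eta) ler_pdivrMr ?expR_gt0//.
  by rewrite mulrC in le1; exact: le_trans le1.
(* From [z] one goes up to [z0 + n.+1%:R], where [n.+1%:R <= z - z0 + 1]; hence the exponent
   [1 - z0]. *)
exists (tail F z0 * expR (- (eta * (1 - z0)))), z0; split=> //.
  by rewrite mulr_gt0// expR_gt0.
move=> z z0z; have zz0 : 0 <= z - z0 by rewrite subr_ge0.
have /andP[n1 n2] := truncn_itv zz0.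
set n := Num.truncn _ in n1 n2.
apply: (@le_trans _ _ (tail F (z0 + n.+1%:R))); last first.
  by apply: tail_nonincreasing => //; rewrite -lerBlDl ltW.
apply: le_trans (geom _); rewrite -mulrA -expRD ler_wpM2l ?(ltW (F0 _))//.
rewrite ler_expR -opprD lerN2 -mulrDr ler_pM2l// -natr1; lra.
Qed.

(** For large [x] the dilation by [l] outweighs the shift: [x <= l * (x - y)], so [tail F x] is at
    least [tail F (l * (x - y))]. *)
Lemma long_tailed_of_liminf F : unbounded_distribution F ->
  (forall e : R, 0 < e -> exists2 l : R, 1 < l &
    ((1 - e)%:E < liminf_tail_ratio F l)%E) ->
  long_tailed F.
Proof.
move=> uF near1; have F0 := uF.2; apply/long_tailedP => // y e y0 e0.
(* Chosen so that [1 - e / (1 + e)] is the inverse of [1 + e]. *)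
have d0 : 0 < e / (1 + e) by rewrite divr_gt0// ltr_wpDl.
have [l l1 /near_lt_liminf/near_gt_ex[M M0 ratio]] := near1 _ d0.
have l10 : 0 < l - 1 by rewrite subr_gt0.
near=> x.
have Mx : M <= x - y by rewrite lerBrDr; near: x; apply: nbhs_pinfty_ge; exact: num_real.
have lx : l * y / (l - 1) <= x by near: x; apply: nbhs_pinfty_ge; exact: num_real.
have := ratio _ Mx; rewrite ltr_pdivlMr// => /ltW le1.
have le2 : tail F (l * (x - y)) <= tail F x.
  apply: tail_nonincreasing => //.
  by move: lx; rewrite ler_pdivrMr//; lra.
have -> : tail F (x - y) = (1 + e) * ((1 - e / (1 + e)) * tail F (x - y)).
  by field; rewrite gt_eqF// ltr_wpDl.
by rewrite ler_pM2l ?ltr_wpDl//; exact: le_trans le2.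
Unshelve. all: by end_near. Qed.

Lemma intermediate_long_tailed F :
  intermediate_regularly_varying F -> long_tailed F.
Proof.
move=> [uF lim1]; apply: long_tailed_of_liminf => // e e0.
have lt1 : ((1 - e)%:E < 1%E :> \bar R)%E by rewrite lte_fin gtrBl.
have : \forall l \near 1^'+, ((1 - e)%:E < liminf_tail_ratio F l)%E.
  have := lim1 [set u | (1 - e)%:E < u]%E; apply.
  by apply: open_nbhs_nbhs; split => //; exact: open_ereal_gt_ereal.
move=> near1.
near (1 : R)^'+ => l; exists l; near: l => //; exact: nbhs_right_gt.
Unshelve. all: by end_near. Qed.

Lemma extended_long_tailed F :
  extended_regularly_varying F -> long_tailed F.
Proof.
move=> [uF [phi phi0 lphi]]; apply: long_tailed_of_liminf => // e e0.
have phi1 : 0 < 1 + phi by rewrite ltr_pwDl.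
have d0 : 0 < e / (1 + phi) by rewrite divr_gt0.
have l1 : 1 < expR (e / (1 + phi)) by rewrite expR_gt1.
(* The power [- phi] of this [l] is at least [1 - e * phi / (1 + phi)], which exceeds [1 - e]. *)
exists (expR (e / (1 + phi))) => //; apply: lt_le_trans (lphi _ (ltW l1)).
rewrite lte_fin -expRM; apply: lt_le_trans (expR_ge1Dx _).
have : e / (1 + phi) * (1 + phi) = e by rewrite divfK ?gt_eqF.
by move: (e / (1 + phi)) d0 => q q0; nra.
Qed.

Lemma regularly_varying_ratio F (alpha l : R) :
  regularly_varying_with_index alpha F -> 0 < l ->
  tail F (l * x) / tail F x @[x --> +oo] --> l `^ (- alpha).
Proof.
move=> [uF alpha0 [L sL FE]] l0.
rewrite -[X in _ --> X]mulr1.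
apply: (@cvg_trans _ ((l `^ (- alpha) * (L (l * x) / L x)) @[x --> +oo])); last first.
  by apply: cvgM; [exact: cvg_cst|exact: sL].
apply: near_eq_cvg; near=> x.
have x0 : 0 < x by near: x; apply: nbhs_pinfty_gt; exact: num_real.
have lx0 : 0 < l * x by rewrite mulr_gt0.
have p0 : 0 < x `^ (- alpha) by rewrite powR_gt0.
have L0 : L x != 0.
  by apply/eqP => Lx; have := uF.2 x; rewrite FE// Lx mulr0 ltxx.
rewrite !FE// powRM ?ltW//; field; rewrite L0/=; exact: lt0r_neq0.
Unshelve. all: by end_near. Qed.

Lemma ratio_regularly_varying F (alpha : R) :
  unbounded_distribution F -> 0 < alpha ->
  (forall l, 0 < l -> tail F (l * x) / tail F x @[x --> +oo] --> l `^ (- alpha)) ->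
  regularly_varying_with_index alpha F.
Proof.
move=> uF alpha0 lim; split=> //.
(* This is the only possible slowly varying factor on the positive half-line. *)
exists (fun x => x `^ alpha * tail F x) => [c c0|x x0]; last first.
  by rewrite powRN mulrA mulVf ?mul1r// gt_eqF// powR_gt0.
rewrite -[X in _ --> X](_ : c `^ alpha * c `^ (- alpha) = 1); last first.
  by rewrite powRN mulfV// gt_eqF// powR_gt0.
apply: (@cvg_trans _ ((c `^ alpha * (tail F (c * x) / tail F x)) @[x --> +oo])); last first.
  by apply: cvgM; [exact: cvg_cst|exact: lim].
apply: near_eq_cvg; near=> x.
have x0 : 0 < x by near: x; apply: nbhs_pinfty_gt; exact: num_real.
have p0 : 0 < x `^ alpha by rewrite powR_gt0.
have T0 := uF.2 x.
by rewrite powRM ?ltW//; field; rewrite !gt_eqF.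
Unshelve. all: by end_near. Qed.

(** The limit of the tail ratio at 2 is a power of 2, whose logarithm recovers the index. *)
Lemma regularly_varying_index_unique F (alpha beta : R) :
  regularly_varying_with_index alpha F -> regularly_varying_with_index beta F ->
  alpha = beta.
Proof.
move=> Fa Fb.
have a := regularly_varying_ratio Fa (ltr0Sn R 1).
have b := regularly_varying_ratio Fb (ltr0Sn R 1).
have ab : 2%:R `^ (- alpha) = 2%:R `^ (- beta) by exact: (cvg_unique _ a b).
have := congr1 (@ln R) ab.
rewrite !ln_powR => /eqP; rewrite -subr_eq0 -mulrBl mulf_eq0.
rewrite (gt_eqF (ln_gt0 _)) ?ltr1n// orbF subr_eq0 eqr_opp => /eqP; exact.
Qed.

Lemma regularly_varying_liminf F (alpha l : R) :
  regularly_varying_with_index alpha F -> 0 < l ->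
  ((l `^ (- alpha))%:E <= liminf_tail_ratio F l)%E.
Proof.
move=> Fa l0; apply/lee_addgt0Pr => e e0.
rewrite -leeBlDr//; apply: near_le_liminf.
have /cvgrPdist_le/(_ e e0) := regularly_varying_ratio Fa l0.
by apply: filterS => x /(le_trans (ler_norm _)); lra.
Qed.

Lemma regularly_varying_extended F (alpha : R) :
  regularly_varying_with_index alpha F -> extended_regularly_varying F.
Proof.
move=> Fa; have [uF alpha0 _] := Fa; split=> //.
exists alpha; first exact: ltW.
by move=> l l1; apply: regularly_varying_liminf => //; exact: lt_le_trans l1.
Qed.

End distribution_classes.

(** * Stability under a phase-type factor *)

Section product_classes.
Context {R : realType} d (Omega : measurableType d) (P : probability Omega R).
Context (V Y : {RV P >-> R}).
Context (V_ge0 : forall w, 0 <= V w).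
Context (VY_indep : independent_rv V Y).
(** The proofs below use the phase-type law only through these three properties. *)
Context (Y_lt0 : P [set w | (Y w < 0)%R] = 0%E).
Context (Y_pos : exists2 c : R, 0 < c & (0 < P [set w | (c < Y w)%R])%E).
Context (Y_exp : exists K kappa : R, [/\ 0 < K, 0 < kappa &
  forall y : R, 0 <= y ->
    (P [set w | (y < Y w)%R] <= (K * expR (- (kappa * y)))%:E)%E]).
Local Notation F := (distribution_function P V).
Local Notation H := (distribution_function P (fun w => V w * Y w)).
Local Notation pr A := (fine (P A)).

Lemma product_tail_lower : exists c q : R, [/\ 0 < c, 0 < q &
  forall x, q * tail F (x / c) <= tail H x].
Proof.
have [c c0 cY] := Y_pos; exists c, (pr [set w | c < Y w]); split=> //.
  rewrite fine_gt0// cY/=.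
  exact: (le_lt_trans (probability_le1 _ (measurable_gt _ _)) (ltry _)).
by move=> x; exact: product_tail_ge.
Qed.

Lemma product_unbounded : unbounded_distribution F -> unbounded_distribution H.
Proof.
move=> [_ F0]; split.
  exact/(nonneg_distribution_function (X := product_rv V Y))/product_lt0.
have [c [q [c0 q0 low]]] := product_tail_lower.
by move=> x; apply: lt_le_trans (low x); rewrite mulr_gt0.
Qed.

(** The tail of the product dominates that of [V] at scale [c], hence decays more slowly than any
    exponential. *)
Lemma light_factor_negligible (b e : R) : long_tailed F -> 0 < b -> 0 < e ->
  \forall x \near +oo, pr [set w | b * x < Y w] <= e * tail H x.
Proof.
move=> LF b0 e0.
have [c [q [c0 q0 low]]] := product_tail_lower.
have [K [kappa [K0 kappa0 tailY]]] := Y_exp.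
(* With this rate the lower bound at [x / c] is of order [expR (- t)] for [t = kappa * b * x / 2],
   while the tail of [Y] at [b * x] is of order [expR (- t)] squared. *)
have eta0 : 0 < kappa * b * c / 2 by rewrite divr_gt0// !mulr_gt0.
have [k [z0 [k0 z00 lowF]]] := long_tailed_exp_lower LF eta0.
near=> x.
have x0 : 0 <= x by near: x; apply: nbhs_pinfty_ge; exact: num_real.
have xz0 : z0 <= x / c.
  by rewrite ler_pdivlMr//; near: x; apply: nbhs_pinfty_ge; exact: num_real.
pose t := kappa * b * x / 2.
(* With [t <= expR t], this absorbs the constants into the spare factor [expR (- t)]. *)
have tK : K <= e * (q * k) * t.
  have h : K / (e * (q * k)) / (kappa * b / 2) <= x.
    by near: x; apply: nbhs_pinfty_ge; exact: num_real.
  rewrite ler_pdivrMr ?divr_gt0 ?mulr_gt0// ler_pdivrMr ?mulr_gt0// in h.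
  by apply: le_trans h _; rewrite le_eqVlt; apply/orP; left; apply/eqP; rewrite /t; field.
have hF := lowF _ xz0.
have tE : kappa * b * c / 2 * (x / c) = t by rewrite /t; field; rewrite gt_eqF.
rewrite tE in hF.
apply: (@le_trans _ _ (K * expR (- (kappa * (b * x))))).
  rewrite -lee_fin fineK ?fin_num_measure//; last exact: measurable_gt.
  by apply: tailY; rewrite mulr_ge0// ltW.
apply: (@le_trans _ _ (e * (q * (k * expR (- t))))); last first.
  by rewrite ler_pM2l//; apply: le_trans (low x); rewrite ler_pM2l.
have -> : - (kappa * (b * x)) = - t + - t by rewrite /t; field.
rewrite expRD !mulrA ler_pM2r ?expR_gt0// expRN ler_pdivrMr ?expR_gt0//.
rewrite -(mulrA e); apply: le_trans tK _; rewrite ler_pM2l ?mulr_gt0//.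
by apply: le_trans (expR_ge1Dx _); rewrite lerDr.
Unshelve. all: by end_near. Qed.

(** For [r] below the liminf of [F], [tail F z <= r^-1 * tail F (l * z)] when [z >= M]. This holds
    at [z = x / u] for [u <= M^-1 * x], and larger values of [Y] are negligible. *)
Lemma product_liminf (l : R) : long_tailed F -> 0 < l ->
  (liminf_tail_ratio F l <= liminf_tail_ratio H l)%E.
Proof.
move=> LF l0; have uF := LF.1; have uH := product_unbounded uF.
have H_ge0 : (0 <= liminf_tail_ratio H l)%E.
  by apply: near_le_liminf; apply: nearW => x; rewrite divr_ge0// ltW// uH.2.
have real_le (r : R) : 0 < r -> (r%:E < liminf_tail_ratio F l)%E ->
    (r%:E <= liminf_tail_ratio H l)%E.
  move=> r0 /near_lt_liminf/near_gt_ex[M M0 ratio].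
  (* The loss of a factor [k < 1] makes room for the negligible term, at most
     [(1 - k) * tail H x]. *)
  apply/lee_mul01Pr => [|k /andP[k0 k1]]; first by rewrite lee_fin ltW.
  have Mi0 : 0 < M^-1 by rewrite invr_gt0.
  have k10 : 0 < 1 - k by rewrite subr_gt0.
  have neg := light_factor_negligible LF Mi0 k10.
  rewrite -EFinM; apply: near_le_liminf; near=> x.
  have x0 : 0 < x by near: x; apply: nbhs_pinfty_gt; exact: num_real.
  have negx : pr [set w | M^-1 * x < Y w] <= (1 - k) * tail H x by near: x.
  have ri0 : 0 <= r^-1 by rewrite invr_ge0 ltW.
  (* Here [delta = 0], so the first term vanishes. *)
  have := product_tail_le (t := l * x) V_ge0 VY_indep x0 (lexx 0) ri0
    (b := M^-1 * x) _.
  rewrite (_ : [set w | 0 < Y w <= 0] = set0); last first.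
    by rewrite -subset0 => w /= /andP[/lt_le_trans h /h]; rewrite ltxx.
  rewrite measure0 mul0r add0r => le1.
  have {}le1 : tail H x <= r^-1 * tail H (l * x) + pr [set w | M^-1 * x < Y w].
    apply: le1 => u u0 ux.
    have Mxu : M <= x / u by rewrite ler_pdivlMr// -ler_pdivlMl.
    have := ratio _ Mxu; rewrite ltr_pdivlMr ?uF.2// mulrA => /ltW.
    by rewrite ler_pdivlMl.
  rewrite ler_pdivlMr ?uH.2//.
  have {}le1 : k * tail H x <= r^-1 * tail H (l * x) by lra.
  by move: le1; rewrite ler_pdivlMl// mulrA (mulrC r).
(* Otherwise a positive real strictly between the two liminfs contradicts [real_le]. *)
rewrite leNgt; apply/negP => HF; move: H_ge0 HF real_le.
case: (liminf_tail_ratio H l) => [h| |]//; last by move=> _; rewrite ltNge leey.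
rewrite lee_fin => h0.
case: (liminf_tail_ratio F l) => [f| |]// hf real_le.
- rewrite lte_fin in hf; have := real_le ((h + f) / 2).
  rewrite lte_fin lee_fin => K.
  have : (h + f) / 2 <= h by apply: K; lra.
  by lra.
- have := real_le (h + 1) _ (ltry _); rewrite lee_fin => K.
  have : h + 1 <= h by apply: K; lra.
  by lra.
Unshelve. all: by end_near. Qed.

(** For [Y = u > delta] the shift [y / u] is at most [y / delta], a fixed shift for [V]. The small
    values of [Y], the comparison and the large values of [Y] each cost [e / 3]. *)
Lemma product_long_tailed : long_tailed F -> long_tailed H.
Proof.
move=> LF; have uF := LF.1; have uH := product_unbounded uF.
apply/long_tailedP => // y e y0 e0.
have [c [q [c0 q0 low]]] := product_tail_lower.
have e3 : 0 < e / 3 by rewrite divr_gt0.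
(* The factor [q] is the one lost in [product_tail_lower]. *)
have [delta0 delta00 small] := small_positive_prob Y (mulr_gt0 q0 e3).
(* Together with [2 * y < x], the bound [delta <= c / 2] gives [x / c <= (x - y) / delta]. *)
pose delta := Num.min delta0 (c / 2).
have delta_gt0 : 0 < delta by rewrite lt_min delta00 divr_gt0.
have smalld : pr [set w | 0 < Y w <= delta] <= q * (e / 3).
  by apply: small; rewrite ge_min lexx.
have yd0 : 0 < y / delta by rewrite divr_gt0.
have [z0 z00 shift] := near_gt_ex ((long_tailedP uF).1 LF _ _ yd0 e3).
have zi0 : 0 < z0^-1 by rewrite invr_gt0.
have neg := light_factor_negligible LF zi0 e3.
near=> x.
have yx : 2 * y < x by near: x; apply: nbhs_pinfty_gt; exact: num_real.
have negx : pr [set w | z0^-1 * x < Y w] <= e / 3 * tail H x by near: x.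
have s0 : 0 < x - y by lra.
have e31 : 0 <= 1 + e / 3 by rewrite ltW// ltr_wpDl.
apply: le_trans (product_tail_le (t := x) (b := z0^-1 * x) V_ge0 VY_indep s0
  (ltW delta_gt0) e31 _) _.
  move=> u du ux; have u0 : 0 < u by exact: lt_trans du.
  have zu : z0 <= x / u by rewrite ler_pdivlMr// -ler_pdivlMl.
  apply: le_trans (shift _ zu); apply: tail_nonincreasing => //.
  by rewrite mulrBl lerD2l lerN2 ler_pM2l// lef_pV2 ?posrE// ltW.
have sm : pr [set w | 0 < Y w <= delta] * tail F ((x - y) / delta) <=
    e / 3 * tail H x.
  apply: (@le_trans _ _ (q * (e / 3) * tail F (x / c))).
    apply: ler_pM => //; [exact: fine_ge0|exact/ltW/uF.2|].
    apply: tail_nonincreasing => //.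
    rewrite ler_pdivrMr// mulrAC ler_pdivlMr//.
    have dc : delta <= c / 2 by rewrite ge_min lexx orbT.
    by nra.
  by rewrite (mulrC q) -(mulrA (e / 3)) ler_pM2l.
have := uH.2 x; lra.
Unshelve. all: by end_near. Qed.

Lemma product_extended :
  extended_regularly_varying F -> extended_regularly_varying H.
Proof.
move=> EF; have LF := extended_long_tailed EF; have [uF [phi phi0 lphi]] := EF.
split; first exact: product_unbounded.
exists phi => // l l1; apply: le_trans (lphi l l1) (product_liminf LF _).
exact: lt_le_trans l1.
Qed.

(** For [l > 1] the liminf of [H] is squeezed between that of [F] and 1. *)
Lemma product_intermediate :
  intermediate_regularly_varying F -> intermediate_regularly_varying H.
Proof.
move=> IF; have LF := intermediate_long_tailed IF; have [uF lim1] := IF.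
have uH := product_unbounded uF.
split=> //; apply: (squeeze_cvge _ lim1 (cvg_cst _)); near=> l.
have l1 : 1 < l by near: l; exact: nbhs_right_gt.
rewrite product_liminf//=; last exact: lt_trans l1.
by rewrite liminf_tail_ratio_le1// ltW.
Unshelve. all: by end_near. Qed.

Lemma product_dominated :
  long_tailed F -> dominated_varying F -> dominated_varying H.
Proof.
move=> LF [uF [l l1 posF]]; split; first exact: product_unbounded.
exists l => //; apply: lt_le_trans posF (product_liminf LF _).
exact: lt_trans l1.
Qed.

(* The liminf of the ratio at [1 / l] bounds its limsup at [l]. *)
Lemma product_regularly_varying (alpha : R) :
  regularly_varying_with_index alpha F -> regularly_varying_with_index alpha H.
Proof.
move=> RF; have LF := extended_long_tailed (regularly_varying_extended RF).
have [uF alpha0 _] := RF; have uH := product_unbounded uF.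
apply: ratio_regularly_varying => // l l0; apply/cvgrPdist_le => e e0.
have lim k : 0 < k -> ((k `^ (- alpha))%:E <= liminf_tail_ratio H k)%E.
  move=> k0; apply: le_trans (product_liminf LF k0).
  exact: regularly_varying_liminf.
have li0 : 0 < l^-1 by rewrite invr_gt0.
have m0 : 0 < l `^ (- alpha) by rewrite powR_gt0.
have lo : ((l `^ (- alpha) - e)%:E < liminf_tail_ratio H l)%E.
  by apply: lt_le_trans (lim l l0); rewrite lte_fin gtrBl.
have up : ((l `^ (- alpha) + e)^-1%:E < liminf_tail_ratio H l^-1)%E.
  apply: lt_le_trans (lim _ li0); rewrite lte_fin.
  have -> : l^-1 `^ (- alpha) = (l `^ (- alpha))^-1.
    rewrite -[LHS](mulfK (lt0r_neq0 m0)) -powRM ?ltW//.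
    by rewrite mulVf ?gt_eqF// powR1 mul1r.
  by rewrite ltf_pV2 ?posrE ?ltrDl// addr_gt0.
have nlo := near_lt_liminf lo.
have [M M0 nup] := near_gt_ex (near_lt_liminf up).
near=> x.
have lox : l `^ (- alpha) - e < tail H (l * x) / tail H x by near: x.
have Mx : M <= l * x.
  by rewrite -ler_pdivrMl//; near: x; apply: nbhs_pinfty_ge; exact: num_real.
(* At [l * x] the ratio for [l^-1] is the inverse of the ratio for [l] at [x], so its lower bound
   becomes an upper bound. *)
have := nup _ Mx; rewrite mulKf ?gt_eqF//.
rewrite -(invf_div (tail H (l * x))) ltf_pV2 ?posrE ?divr_gt0 ?uH.2 ?addr_gt0//.
by rewrite ler_norml => upx; apply/andP; split; lra.
Unshelve. all: by end_near. Qed.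

End product_classes.

Theorem corollary3p15 (R : realType) (d : measure_display)
    (Omega : measurableType d) (P : probability Omega R)
    (V Y : {RV P >-> R}) (p : nat) (pi : 'rV[R]_p) (T : 'M[R]_p)
    (V_ge0 : forall w, 0 <= V w)
    (Y_PH : phase_type Y pi T)
    (VY_indep : independent_rv V Y) :
  let F_V := distribution_function P V in
  let F_VY := distribution_function P (fun w => V w * Y w) in
  [/\ regularly_varying F_V ->
        regularly_varying F_VY /\
        (forall alpha beta : R, regularly_varying_with_index alpha F_V ->
           regularly_varying_with_index beta F_VY -> alpha = beta),
      extended_regularly_varying F_V -> extended_regularly_varying F_VY,
      intermediate_regularly_varying F_V -> intermediate_regularly_varying F_VY,
      dominated_varying F_V /\ long_tailed F_V ->
        dominated_varying F_VY /\ long_tailed F_VY &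
      long_tailed F_V -> long_tailed F_VY].
Proof.
move=> F_V F_VY.
have Y0 := phase_type_lt0 Y_PH.
have Ypos := phase_type_pos Y_PH.
have Yexp := phase_type_exponential_tail Y_PH.
split.
- move=> [alpha RV]; split.
    by exists alpha; exact: product_regularly_varying.
  move=> a b Ra Rb; apply: regularly_varying_index_unique Rb.
  exact: product_regularly_varying.
- exact: product_extended.
- exact: product_intermediate.
- by move=> [DF LF]; split; [exact: product_dominated|exact: product_long_tailed].
- exact: product_long_tailed.
Qed.
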